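(* Let $\Delta^{(0)}\subset\mathbb{D}$ be a triangle in the Poincaré disk, defined by three geodesics with boundary endpoints $a_0^{(0)},\dots,a_5^{(0)}\in\partial\mathbb{D}$, and let $b^{(0)}=(b_0^{(0)},\dots,b_5^{(0)})$ be the vector of arc lengths between consecutive endpoints. Let $A$ be the circulant $6\times 6$ matrix such that $(Ab)_j=\frac12 b_j+\frac12 b_{j+2}$ for $j\in\mathbb{Z}/6\mathbb{Z}$, put $b^{(n)}=A^nb^{(0)}$ for $n\ge 0$, and let $\Delta^{(n)}$ be the hyperbolic triangle determined by $b^{(n)}$. Then the sequence of triangles $\Delta^{(n)}$ converges to a regular triangle.
   Context: The Poincaré disk $\mathbb{D}$ is the model for the hyperbolic plane; its geodesics are the circular arcs (and diameters) orthogonal to the boundary circle $\partial\mathbb{D}=\mathbb{S}^1$. The boundary circle is identified with $\mathbb{R}/\mathbb{Z}$ (total length normalized to $1$). A hyperbolic triangle is defined by three geodesics $s_0,s_1,s_2$, its vertices being their pairwise intersection points. The geodesics meet $\partial\mathbb{D}$ in six points, labelled $a_0,\dots,a_5$ in cyclic order around the circle, such that $s_j$ has endpoints $a_j$ and $a_{j+3}$ for $j=0,1,2$. For $j\in\mathbb{Z}/6\mathbb{Z}$, $b_j$ is the length of the boundary arc between the consecutive points $a_j$ and $a_{j+1}$ (with $a_6=a_0$), so $\sum_{j=0}^5b_j=1$. Given $b^{(n)}$, the triangle $\Delta^{(n)}$ is obtained as follows: normalizing $a_0^{(n)}=0$, set $a_i^{(n)}=a_{i-1}^{(n)}+b_{i-1}^{(n)}$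 for $i=1,\dots,5$; for $i=0,1,2$ let $s_i^{(n)}$ be the geodesic with endpoints $a_i^{(n)}$ and $a_{i+3}^{(n)}$; then $\Delta^{(n)}$ is the triangle whose vertices are the intersection points of these three geodesics. A hyperbolic triangle is regular if all its angles are equal. A sequence of hyperbolic triangles converges to a regular triangle iff there exists $0\le a<\frac{\pi}{3}$ such that the sequence of associated (inner) angle vectors in $\mathbb{R}^3$ converges to $(a,a,a)$ in the Euclidean norm.
   Formalization: If b_0+b_2+b_4 = b_1+b_3+b_5, e.g. b=(1/6,1/12,1/6,1/6,1/6,1/4), the angles tend to π/3, which a<π/3 excludes; so convergence to a regular triangle is stated when these sums differ, and when they agree the angles tend to π/3 along those n for which Δ^(n) is a genuine triangle. *)

(* Defs.v *)
From HB Require Import structures.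
From mathcomp Require Export all_boot all_order all_algebra.
From mathcomp Require Export all_classical all_reals all_analysis.
From mathcomp Require Export complex.

#[export] Set Implicit Arguments.
#[export] Unset Strict Implicit.
#[export] Unset Printing Implicit Defensive.

Export Order.TTheory GRing.Theory Num.Theory.
Export numFieldNormedType.Exports.

#[global] Open Scope classical_set_scope.
#[global] Open Scope ring_scope.
#[global] Open Scope complex_scope.

Section PoincareDisk.
Variable R : realType.
Implicit Types (c p q u v w z : R[i]) (t : R).

Definition cnorm z : R := ComplexField.Normc.normc z.

(* The Euclidean inner product of the plane. *)
Definition dot u v : R := complex.Re (u * conjc v).

Definition disk : set R[i] := [set z | cnorm z < 1].

(* The boundary circle as R/Z, with total length 1. *)
Definition bdpt t : R[i] := cos (2 * pi * t) +i* sin (2 * pi * t).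

(* The circle with centre c through p is orthogonal at p to the unit circle
   when its radius p - c is perpendicular to the radius p. *)
Definition orthogonal_at c p : Prop := dot (p - c) p = 0.

(* The geodesic with endpoints p != q on the unit circle. The first disjunct
   never holds for q = - p. *)
Definition geodesic p q : set R[i] := [set z | disk z /\
  ((exists c, [/\ orthogonal_at c p, orthogonal_at c q,
                  cnorm (q - c) = cnorm (p - c) &
                  cnorm (z - c) = cnorm (p - c)])
   \/ (q = - p /\ exists t, z = t%:C * p))].

(* Tangent direction at v of the geodesic segment from v to w. The disk
   automorphism z |-> (z - v) / (1 - v^* z) has derivative
   1 / (1 - |v|^2) > 0 at v, hence fixes tangent directions at v, and it maps
   the segment from v to w onto a Euclidean segment starting from 0. *)
Definition direction v w : R[i] := (w - v) / (1 - conjc v * w).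

(* Angles in the disk are Euclidean angles between tangent vectors. *)
Definition angle v w w' : R :=
  acos (dot (direction v w) (direction v w')
        / (cnorm (direction v w) * cnorm (direction v w'))).

(* Lifts to R of six points of R/Z in cyclic order. *)
Definition cyclic_order (a : 'I_6 -> R) : Prop :=
  (forall i j : 'I_6, (i < j)%N -> a i < a j) /\ a ord_max < a ord0 + 1.

(* Here j + 1 is computed modulo 6. *)
Definition arcs (a : 'I_6 -> R) : 'cV[R]_6 :=
  \col_j (a (j + 1) - a j + (j == ord_max)%:R).

Definition side (a : 'I_6 -> R) (i : 'I_3) : set R[i] :=
  geodesic (bdpt (a (lshift 3 i))) (bdpt (a (rshift 3 i))).

(* Indices are modulo 3: vertex i is opposite to side i. *)
Definition triangle (a : 'I_6 -> R) : 'I_3 -> R[i] :=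
  fun i => xget 0 (side a (i + 1) `&` side a (i + 2)).

(* Vertices that are pairwise intersections of three geodesics are either
   distinct or all equal. *)
Definition nondegenerate (T : 'I_3 -> R[i]) : Prop := injective T.

Definition angles (T : 'I_3 -> R[i]) : 'rV[R]_3 :=
  \row_i angle (T i) (T (i + 1)) (T (i + 2)).

Definition euclidean_norm n (x : 'rV[R]_n) : R :=
  Num.sqrt (\sum_(i < n) x ord0 i ^+ 2).

Definition converges_to_regular (T : nat -> 'I_3 -> R[i]) : Prop :=
  exists a : R, [/\ 0 <= a, a < pi / 3 &
    euclidean_norm (angles (T n) - const_mx a) @[n --> \oo] --> (0 : R)].

(* a_0 = 0 and a_i = a_(i-1) + b_(i-1). *)
Definition endpoints (b : 'cV[R]_6) (i : 'I_6) : R :=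
  \sum_(k < 6 | (k < i)%N) b k ord0.

(* Here j + 2 is computed modulo 6. *)
Definition A : 'M[R]_6 :=
  \matrix_(j, k) (2^-1 * (k == j)%:R + 2^-1 * (k == j + 2)%:R).

Definition triangles (b : 'cV[R]_6) (n : nat) : 'I_3 -> R[i] :=
  triangle (endpoints (A ^+ n *m b)).

(* b_0 + b_2 + b_4 = b_1 + b_3 + b_5. Both sums are invariant under A, so in
   this case A^n b tends to (1/6, ..., 1/6), the three geodesics tend to
   concurrent diameters, and the angles to pi / 3. *)
Definition balanced (b : 'cV[R]_6) : Prop :=
  \sum_(j < 6 | ~~ odd j) b j ord0 = \sum_(j < 6 | odd j) b j ord0.

End PoincareDisk.

Arguments A {R}.

(* Main.v *)
(* In the disk, the geodesic with endpoints e^{i(m-h)} and e^{i(m+h)} is the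
   zero set of 2 <z, e^{im}> - cos h (1 + |z|^2), a linear form in
   (z, 1 + |z|^2), so that the vertices of a triangle obey Cramer's rule. After
   reversing the middle side, it follows that the values of the three forms at
   the opposite vertices have the same sign. Hence, as soon as the three
   geodesics are not concurrent, the cosine of each inner angle is the opposite
   of the normalized Lorentz product of two forms, which is continuous in b.
   The difference between (A b)_j and the mean m_j of b over the parity class of
   j is -1/2 times that between b_(j+4) and m_(j+4) = m_j, so A^n b converges to
   (e, 1/3 - e, e, 1/3 - e, e, 1/3 - e). There the three angles have cosine
   (1/2 + C^2) / (1 - C^2) with C = cos (pi (1/3 + e)), which is at least 1/2,
   with equality exactly in the balanced case. *)

From mathcomp Require Import ring lra.
Require Import Defs.

(** * Geodesics as zero sets of linear forms *)

Definition sqnorm (R : realType) (z : R[i]) : R :=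
  complex.Re z ^+ 2 + complex.Im z ^+ 2.

(** The Lorentz product of [(u, C)] with [(2 z, 1 + |z|^2)], a vector on the ray of [z] in the
    hyperboloid model. *)
Definition pole_form (R : realType) (C : R) (u z : R[i]) : R :=
  2 * dot z u - C * (1 + sqnorm z).

Lemma dotE (R : realType) (u v : R[i]) :
  dot u v = complex.Re u * complex.Re v + complex.Im u * complex.Im v.
Proof. by case: u v => [x y] [x' y']; rewrite /dot /= mulrN opprK. Qed.

Lemma cnormE (R : realType) (z : R[i]) : cnorm z = Num.sqrt (sqnorm z).
Proof. by case: z. Qed.

Lemma sqnorm_ge0 (R : realType) (z : R[i]) : 0 <= sqnorm z.
Proof. by rewrite addr_ge0 ?sqr_ge0. Qed.

Lemma diskE (R : realType) (z : R[i]) : disk z <-> sqnorm z < 1.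
Proof.
rewrite /disk /= cnormE -[X in _ < X]sqrtr1; split; last first.
  by move=> h; rewrite ltr_sqrt.
by rewrite ltr_sqrt.
Qed.

Lemma cnorm_eqE (R : realType) (z w : R[i]) :
  (cnorm z = cnorm w) = (sqnorm z = sqnorm w).
Proof.
rewrite !cnormE; apply/propext; split=> [|->//] /(congr1 (fun x => x ^+ 2)).
by rewrite !sqr_sqrtr ?sqnorm_ge0.
Qed.

(** A circle orthogonal to the unit circle at both endpoints is centred at the pole
    [e^{im} / cos h]. When [cos h = 0], the pole is at infinity and the geodesic is a diameter. *)
Lemma geodesicE (R : realType) (m h : R) : 0 < sin h ->
  geodesic (cos (m - h) +i* sin (m - h)) (cos (m + h) +i* sin (m + h)) =
  [set z | disk z /\ pole_form (cos h) (cos m +i* sin m) z = 0].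
Proof.
move=> sh; apply/seteqP; split=> -[x y] [dz H]; split=> //.
  rewrite /pole_form dotE /sqnorm /=.
  have ep := cos2Dsin2 (m - h); have eq := cos2Dsin2 (m + h).
  have em := cos2Dsin2 m; have eh := cos2Dsin2 h.
  case: H => [[[cx cy] []]|[] [e1 e2] [t []]].
    rewrite /orthogonal_at !dotE !cnorm_eqE /sqnorm /=.
    move: ep eq sh em eh; rewrite cosB sinB cosD sinD.
    move: (cos m) (sin m) (cos h) (sin h) => cm sm ch s.
    move=> ep eq sh em eh H1 H2 _ H3.
    (* The sum and the difference of the two orthogonality conditions give the coordinates of the
       centre in the frame [e^{im}, i e^{im}]. *)
    have c1 : ch * (cm * cx + sm * cy) = 1 by lra.
    have : s * (cm * cy - sm * cx) = 0 by lra.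
    move/eqP; rewrite mulf_eq0 gt_eqF //= => /eqP c2.
    (* By orthogonality, the squared radius is [|c|^2 - 1]. *)
    have e : 1 + (x ^+ 2 + y ^+ 2) = 2 * (x * cx + y * cy) by lra.
    have ex : cx = (cm * cx + sm * cy) * cm.
      by move: (congr1 ( *%R cx) em) (congr1 ( *%R sm) c2); lra.
    have ey : cy = (cm * cx + sm * cy) * sm.
      by move: (congr1 ( *%R cy) em) (congr1 ( *%R cm) c2); lra.
    rewrite e; move: (cm * cx + sm * cy) c1 ex ey => k c1 -> ->.
    by move: (congr1 ( *%R (2 * (x * cm + y * sm))) c1); lra.
  move: e1 e2 ep eq sh em eh; rewrite cosB sinB cosD sinD.
  move: (cos m) (sin m) (cos h) (sin h) => cm sm ch s.
  move=> e1 e2 ep eq sh em eh ex ey.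
  (* The sum of the endpoints is [2 cos h e^{im}], and here they are antipodal. *)
  have ch0 : ch = 0.
    move: (congr1 ( *%R cm) e1) (congr1 ( *%R sm) e2) (congr1 ( *%R ch) em).
    by lra.
  by move: ex ey; rewrite ch0 => -> ->; lra.
move: H; rewrite /pole_form !dotE /sqnorm /= => H.
have em := cos2Dsin2 m; have eh := cos2Dsin2 h.
have [ch0|ch0] := eqVneq (cos h) 0; [right|left].
  split.
    apply/eqP; rewrite eq_complex /= cosB sinB cosD sinD ch0.
    by apply/andP; split; apply/eqP; lra.
  exists (x * cos (m - h) + y * sin (m - h)).
  apply/eqP; rewrite eq_complex /=.
  move: H sh em eh; rewrite cosB sinB ch0.
  move: (cos m) (sin m) (sin h) => cm sm s H sh em eh.
  have H0 : x * cm + y * sm = 0 by lra.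
  have s1 : s = 1 by nra.
  rewrite s1; apply/andP; split; apply/eqP.
    move: (congr1 ( *%R x) em) (congr1 ( *%R cm) H0); lra.
  move: (congr1 ( *%R y) em) (congr1 ( *%R sm) H0); lra.
exists (cos m / cos h +i* (sin m / cos h)).
rewrite /orthogonal_at !dotE !cnorm_eqE /sqnorm /=.
move: H sh em eh ch0; rewrite cosB sinB cosD sinD.
move: (cos m) (sin m) (cos h) (sin h) => cm sm ch s H sh em eh ch0.
set k := ch^-1; have hk : k * ch = 1 by rewrite mulVf.
move: k hk => k hk {ch0}.
have hp : (cm * ch + sm * s) * (cm * k) + (sm * ch - cm * s) * (sm * k) = 1.
  by move: (congr1 ( *%R (k * ch)) em); lra.
have hq : (cm * ch - sm * s) * (cm * k) + (sm * ch + cm * s) * (sm * k) = 1.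
  by move: (congr1 ( *%R (k * ch)) em); lra.
have hz : 2 * (x * (cm * k) + y * (sm * k)) = 1 + (x ^+ 2 + y ^+ 2).
  move: (congr1 ( *%R k) H) (congr1 ( *%R (1 + (x ^+ 2 + y ^+ 2))) hk); lra.
have ep : (cm * ch + sm * s) ^+ 2 + (sm * ch - cm * s) ^+ 2 = 1.
  by move: (congr1 ( *%R (ch ^+ 2 + s ^+ 2)) em); lra.
have eq : (cm * ch - sm * s) ^+ 2 + (sm * ch + cm * s) ^+ 2 = 1.
  by move: (congr1 ( *%R (ch ^+ 2 + s ^+ 2)) em); lra.
by split; lra.
Qed.

(** * Intersection of two geodesics *)

Definition cross (R : realType) (u v : R[i]) : R :=
  complex.Re u * complex.Im v - complex.Im u * complex.Re v.

(** Cramer's rule: take the inner product of [z] with the planar identity [cross u1 u2 u0 + cross u2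
    u0 u1 + cross u0 u1 u2 = 0], where each cross product multiplies the remaining vector. *)
Lemma pole_form_vertex (R : realType) (C0 C1 C2 : R) (u0 u1 u2 z : R[i]) :
  pole_form C1 u1 z = 0 -> pole_form C2 u2 z = 0 ->
  pole_form C0 u0 z * cross u1 u2 =
  - (1 + sqnorm z) *
    (C0 * cross u1 u2 + C1 * cross u2 u0 + C2 * cross u0 u1).
Proof.
case: u0 u1 u2 z => [x0 y0] [x1 y1] [x2 y2] [x y].
rewrite /pole_form /cross /sqnorm !dotE /= => h1 h2.
move: (congr1 ( *%R (x0 * y2 - y0 * x2)) h1) (congr1 ( *%R (x0 * y1 - y0 * x1)) h2).
lra.
Qed.

(** The two equations determine [z / (1 + |z|^2)], and [r / (1 + r^2)] is injective for
    [0 <= r < 1]. *)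
Lemma pole_form_inter_eq (R : realType) (C1 C2 : R) (u1 u2 z w : R[i]) :
  cross u1 u2 != 0 -> disk z -> disk w ->
  pole_form C1 u1 z = 0 -> pole_form C2 u2 z = 0 ->
  pole_form C1 u1 w = 0 -> pole_form C2 u2 w = 0 -> z = w.
Proof.
move=> cr /diskE + /diskE.
case: u1 u2 z w cr => [x1 y1] [x2 y2] [x y] [x' y'].
rewrite /pole_form /cross /sqnorm !dotE /= => cr dz dw h1 h2 h3 h4.
move eTz : (1 + (x ^+ 2 + y ^+ 2)) h1 h2 => T h1 h2.
move eTw : (1 + (x' ^+ 2 + y' ^+ 2)) h3 h4 => T' h3 h4.
have ex : x * T' = x' * T.
  apply: (mulfI cr).
  move: (congr1 ( *%R (T' * y2)) h1) (congr1 ( *%R (T' * y1)) h2)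
        (congr1 ( *%R (T * y2)) h3) (congr1 ( *%R (T * y1)) h4); lra.
have ey : y * T' = y' * T.
  apply: (mulfI cr).
  move: (congr1 ( *%R (T' * x2)) h1) (congr1 ( *%R (T' * x1)) h2)
        (congr1 ( *%R (T * x2)) h3) (congr1 ( *%R (T * x1)) h4); lra.
(* This compares the squared norms of [T' z = T w]. The second factor is positive in the disk. *)
have en : (x ^+ 2 + y ^+ 2 - (x' ^+ 2 + y' ^+ 2))
          * (1 - (x ^+ 2 + y ^+ 2) * (x' ^+ 2 + y' ^+ 2)) = 0.
  move: (congr1 (fun t => t ^+ 2) ex) (congr1 (fun t => t ^+ 2) ey).
  rewrite -eTz -eTw; lra.
have eT : T = T'.
  move/eqP: en; rewrite mulf_eq0 => /orP[/eqP|/eqP]; rewrite -eTz -eTw; first by lra.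
  nra.
have T0 : T' != 0 by rewrite gt_eqF // -eTw ltr_pwDl // addr_ge0 ?sqr_ge0.
by move: ex ey; rewrite eT => /(mulIf T0) -> /(mulIf T0) ->.
Qed.

(** Multiplied by the square of [cross u1 u2], the condition that the chords meet inside the disk
    becomes the assumed inequality. *)
Lemma pole_form_inter (R : realType) (C1 C2 : R) (u1 u2 : R[i]) :
  sqnorm u1 = 1 -> sqnorm u2 = 1 -> cross u1 u2 != 0 ->
  (dot u1 u2 - C1 * C2) ^+ 2 < (1 - C1 ^+ 2) * (1 - C2 ^+ 2) ->
  exists z, [/\ disk z, pole_form C1 u1 z = 0 & pole_form C2 u2 z = 0].
Proof.
case: u1 u2 => [x1 y1] [x2 y2]; rewrite /cross /sqnorm dotE /=.
move=> e1 e2 cr lt.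
pose D := x1 * y2 - y1 * x2; have D0 : D != 0 by [].
have D2 : D ^+ 2 = 1 - (x1 * x2 + y1 * y2) ^+ 2.
  by rewrite /D; move: (congr1 ( *%R (x1 ^+ 2 + y1 ^+ 2)) e2); lra.
(* The intersection in the Klein model, that is, of the chords. *)
pose p := (C1 * y2 - C2 * y1) / D; pose q := (x1 * C2 - x2 * C1) / D.
have hp1 : p * x1 + q * y1 = C1 by rewrite /p /q /D; field.
have hp2 : p * x2 + q * y2 = C2 by rewrite /p /q /D; field.
have n1 : p ^+ 2 + q ^+ 2 < 1.
  have : 0 < D ^+ 2 by rewrite exprn_even_gt0.
  move=> D2gt; rewrite -(ltr_pM2r D2gt) mul1r.
  have -> : (p ^+ 2 + q ^+ 2) * D ^+ 2 =
     (C1 * y2 - C2 * y1) ^+ 2 + (x1 * C2 - x2 * C1) ^+ 2.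
    by rewrite /p /q /D; field.
  rewrite D2; move: (congr1 ( *%R (C1 ^+ 2)) e2) (congr1 ( *%R (C2 ^+ 2)) e1); lra.
(* A Klein point [k] corresponds to the Poincaré point [k / (1 + r)] with [r = sqrt (1 - |k|^2)]. *)
pose r := Num.sqrt (1 - (p ^+ 2 + q ^+ 2)).
have r0 : 0 < r by rewrite sqrtr_gt0 subr_gt0.
have r2 : r ^+ 2 = 1 - (p ^+ 2 + q ^+ 2) by rewrite sqr_sqrtr // subr_ge0 ltW.
move: p q r r0 r2 hp1 hp2 n1 => p q r r0 r2 hp1 hp2 n1.
have r1 : 1 + r != 0 by rewrite gt_eqF // addr_gt0.
have ez : sqnorm (p / (1 + r) +i* (q / (1 + r))) = (1 - r) / (1 + r).
  rewrite /sqnorm /=.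
  transitivity ((p ^+ 2 + q ^+ 2) / (1 + r) ^+ 2); first by field.
  have -> : p ^+ 2 + q ^+ 2 = (1 - r) * (1 + r) by lra.
  by field.
exists (p / (1 + r) +i* (q / (1 + r))).
rewrite /pole_form !dotE ez /= ; split.
- by apply/diskE; rewrite ez ltr_pdivrMr ?mul1r ?addr_gt0 //; lra.
- by rewrite -hp1; field.
- by rewrite -hp2; field.
Qed.

(** * Angles at the vertices *)

(* The isometry moving v to 0 used in [direction] maps the geodesic through v
   with form [pole_form C u] to the diameter orthogonal to this vector. *)
Definition tangent_normal (R : realType) (C : R) (u v : R[i]) : R[i] :=
  u - C%:C * v.

(** As [v] lies on both geodesics, the cross terms add up to [- C1 C2 (1 + |v|^2)]. What remains is
    the Lorentz product of the forms, independent of [v]. *)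
Lemma dot_tangent_normal (R : realType) (C1 C2 : R) (u1 u2 v : R[i]) :
  pole_form C1 u1 v = 0 -> pole_form C2 u2 v = 0 ->
  dot (tangent_normal C1 u1 v) (tangent_normal C2 u2 v) = dot u1 u2 - C1 * C2.
Proof.
case: u1 u2 v => [x1 y1] [x2 y2] [x y].
rewrite /pole_form /tangent_normal !dotE /sqnorm /= => h1 h2.
by move: (congr1 ( *%R C2) h1) (congr1 ( *%R C1) h2); lra.
Qed.

Lemma sqnormE (R : realType) (u : R[i]) : sqnorm u = dot u u.
Proof. by rewrite dotE /sqnorm !expr2. Qed.

Lemma invcE (R : realType) (z : R[i]) :
  z^-1 = complex.Re z / sqnorm z +i* (- (complex.Im z / sqnorm z)).
Proof. by case: z. Qed.

(** The sign of the form at [w] thus tells on which side of the geodesic the segment leaves [v]. The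
    factor [k] is [(1 - |v|^2) / 2] divided by [|1 - v^* w|^2]. *)
Lemma dot_direction (R : realType) (v w : R[i]) : disk v -> disk w ->
  exists2 k : R, 0 < k & forall C u, pole_form C u v = 0 ->
    dot (direction v w) (tangent_normal C u v) = k * pole_form C u w.
Proof.
case: v w => [x y] [x' y'] /diskE dv /diskE dw.
have [n en] : exists n, n = sqnorm (1 - conjc (x +i* y) * (x' +i* y')) by eexists.
have n0 : 0 < n.
  have -> : n = (1 - sqnorm (x +i* y)) * (1 - sqnorm (x' +i* y')) +
                sqnorm ((x +i* y) - (x' +i* y')).
    by rewrite en /sqnorm /=; lra.
  by rewrite ltr_pwDl ?sqnorm_ge0 // mulr_gt0 // subr_gt0.
exists ((1 - sqnorm (x +i* y)) / 2 / n).
  by rewrite !divr_gt0 // subr_gt0.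
move=> C [a b]; rewrite /direction invcE -en.
rewrite /pole_form !dotE /sqnorm /= => h.
move: n^-1 => l.
move: (congr1 ( *%R (l * (2 * (x * x' + y * y') - 1 - x' ^+ 2 - y' ^+ 2) / 2)) h).
by rewrite !mulr0; lra.
Qed.

(** Each direction is a multiple of the quarter turn of the other normal. The positivity assumption
    forces opposite signs on the two multiples, so the angle of the directions is supplementary to
    that of the normals. *)
Lemma cos_planar (R : realType) (d1 d2 n1 n2 : R[i]) :
  dot d1 n2 = 0 -> dot d2 n1 = 0 -> 0 < dot d1 n1 * dot d2 n2 ->
  dot d1 d2 / (cnorm d1 * cnorm d2) = - dot n1 n2 / (cnorm n1 * cnorm n2).
Proof.
move=> o1 o2 lt.
have nz (u w : R[i]) : dot u w != 0 -> 0 < sqnorm w.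
  rewrite lt_def sqnorm_ge0 andbT; apply: contra.
  rewrite paddr_eq0 ?sqr_ge0 // !expf_eq0 /= dotE.
  by move=> /andP[/eqP-> /eqP->]; rewrite !mulr0 addr0.
have /nz n1_gt0 : dot d1 n1 != 0.
  by apply: contraTneq lt => ->; rewrite mul0r ltxx.
have /nz n2_gt0 : dot d2 n2 != 0.
  by apply: contraTneq lt => ->; rewrite mulr0 ltxx.
pose l := cross n2 d1 / sqnorm n2; pose m := cross n1 d2 / sqnorm n1.
have perp (d n : R[i]) : dot d n = 0 -> 0 < sqnorm n ->
  d = (cross n d / sqnorm n)%:C * ('i * n).
  move=> o n_gt0; have n0 : sqnorm n != 0 by rewrite gt_eqF.
  have : sqnorm n * (cross n d / sqnorm n) = cross n d.
    by rewrite mulrCA mulfV ?mulr1.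
  move: (cross n d / sqnorm n) => k.
  case: d n o {n_gt0} n0 => [a b] [c d]; rewrite dotE /cross /sqnorm /= => o n0 nk.
  apply/eqP; rewrite eq_complex /=; apply/andP; split; apply/eqP; apply: (mulfI n0).
    by move: (congr1 ( *%R c) o) (congr1 ( *%R d) nk); lra.
  by move: (congr1 ( *%R d) o) (congr1 ( *%R c) nk); lra.
have e1 := perp _ _ o1 n2_gt0; have e2 := perp _ _ o2 n1_gt0.
move: lt; rewrite {}e1 {}e2 -/l -/m !cnormE.
have scale (t : R) (u : R[i]) :
    Num.sqrt (sqnorm (t%:C * ('i * u))) = `|t| * Num.sqrt (sqnorm u).
  rewrite -sqrtr_sqr -sqrtrM ?sqr_ge0 //; congr Num.sqrt.
  by case: u => a b; rewrite /sqnorm /=; lra.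
rewrite !scale; move: l m => l m lt.
have E : dot (l%:C * ('i * n2)) (m%:C * ('i * n1)) = l * m * dot n1 n2.
  by case: n1 n2 {lt o1 o2 n1_gt0 n2_gt0} => [a b] [c d]; rewrite !dotE /=; lra.
have {}lt : l * m < 0.
  rewrite -oppr_gt0; move: lt.
  have -> : dot (l%:C * ('i * n2)) n1 * dot (m%:C * ('i * n1)) n2 =
            - (l * m) * cross n1 n2 ^+ 2.
    by case: n1 n2 {o1 o2 n1_gt0 n2_gt0 E} => [a b] [c d];
       rewrite !dotE /cross /=; lra.
  by apply: contraTT; rewrite -!leNgt => /mulr_le0_ge0; apply; exact: sqr_ge0.
have s1 : Num.sqrt (sqnorm n1) != 0 by rewrite gt_eqF // sqrtr_gt0.
have s2 : Num.sqrt (sqnorm n2) != 0 by rewrite gt_eqF // sqrtr_gt0.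
have /andP[l0 m0] : (l != 0) && (m != 0) by rewrite -negb_or -mulf_eq0 lt_eqF.
rewrite E mulrACA -normrM ltr0_norm //.
by field; rewrite l0 m0 s1 s2.
Qed.

(** By Cramer's rule, the values of forms 1 and 2 at their opposite vertices are negative multiples
    of the same nonzero determinant, divided by cross products of equal sign. Their product is
    therefore positive, as [cos_planar] requires. *)
Lemma angle_vertex (R : realType) (C0 C1 C2 : R) (u0 u1 u2 v0 v1 v2 : R[i]) :
  disk v0 -> disk v1 -> disk v2 ->
  pole_form C1 u1 v0 = 0 -> pole_form C2 u2 v0 = 0 ->
  pole_form C2 u2 v1 = 0 -> pole_form C0 u0 v1 = 0 ->
  pole_form C0 u0 v2 = 0 -> pole_form C1 u1 v2 = 0 ->
  0 < cross u2 u0 * cross u0 u1 ->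
  C0 * cross u1 u2 + C1 * cross u2 u0 + C2 * cross u0 u1 != 0 ->
  angle v0 v1 v2 = acos (- (dot u1 u2 - C1 * C2) /
    (Num.sqrt (sqnorm u1 - C1 ^+ 2) * Num.sqrt (sqnorm u2 - C2 ^+ 2))).
Proof.
move=> d0 d1 d2 z10 z20 z21 z01 z02 z12 cr D0.
have [k1 k1_gt0 dir1] := dot_direction d0 d1.
have [k2 k2_gt0 dir2] := dot_direction d0 d2.
have F1 := @pole_form_vertex _ C1 _ _ u1 _ _ _ z21 z01.
have F2 := @pole_form_vertex _ C2 _ _ u2 _ _ _ z02 z12.
rewrite /angle; congr acos.
rewrite (@cos_planar _ _ _ (tangent_normal C1 u1 v0) (tangent_normal C2 u2 v0)).
- by rewrite !cnormE !sqnormE !dot_tangent_normal // -!expr2.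
- by rewrite dir1 // z21 mulr0.
- by rewrite dir2 // z12 mulr0.
rewrite dir1 // dir2 // mulrACA (pmulr_rgt0 _ (mulr_gt0 k1_gt0 k2_gt0)).
rewrite -(pmulr_lgt0 _ cr) mulrACA F1 F2.
set D := (X in _ * X * _); set D' := (X in _ * (_ * X)).
have -> : D' = D by rewrite /D /D'; ring.
have {}D0 : D != 0 by move: D0; apply: contra_neq => <-; rewrite /D; ring.
rewrite mulrACA pmulr_lgt0 -?expr2 ?exprn_even_gt0 //.
by rewrite mulrNN mulr_gt0 // ltr_pwDl ?sqnorm_ge0.
Qed.

(** * The three sides of a triangle *)

Definition unit_point (R : realType) (x : R) : R[i] := cos x +i* sin x.

Lemma bdpt_geodesic (R : realType) (s t : R) : s < t -> t < s + 1 ->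
  geodesic (bdpt s) (bdpt t) =
  [set z | disk z /\
     pole_form (cos (pi * (t - s))) (unit_point (pi * (s + t))) z = 0].
Proof.
move=> st ts; rewrite -geodesicE; last first.
  apply: sin_gt0_pi; have := pi_gt0 R; nra.
by congr geodesic; rewrite /bdpt; congr (cos _ +i* sin _); ring.
Qed.

(* The sign reverses side 1, which makes the three poles cyclically symmetric:
   see [cross_pole_dir_lt0]. *)
Definition pole_cos (R : realType) (a : 'I_6 -> R) (i : 'I_3) : R :=
  (-1) ^+ i * cos (pi * (a (rshift 3 i) - a (lshift 3 i))).

Definition pole_dir (R : realType) (a : 'I_6 -> R) (i : 'I_3) : R[i] :=
  (-1) ^+ i * unit_point (pi * (a (lshift 3 i) + a (rshift 3 i))).

(** With half-lengths [h, h'] of the arcs and angle [D] between the poles, the right side minus the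
    left is [(cos (h - h') - cos D) (cos D - cos (h + h'))]. Interleaving of the endpoints makes
    each factor twice a product of two positive sines. *)
Lemma crossing (R : realType) (s s' t t' : R) :
  s < s' -> s' < t -> t < t' -> t' < s + 1 ->
  (cos (pi * (s' + t') - pi * (s + t)) -
     cos (pi * (t - s)) * cos (pi * (t' - s'))) ^+ 2 <
  (1 - cos (pi * (t - s)) ^+ 2) * (1 - cos (pi * (t' - s')) ^+ 2).
Proof.
move=> h1 h2 h3 h4; have p0 := pi_gt0 R.
have S (x : R) : 0 < x < 1 -> 0 < sin (pi * x).
  move=> /andP[x0 x1]; apply: sin_gt0_pi.
  by rewrite mulr_gt0 //= gtr_pMr.
have hp (x y : R) : cos (x - y) - cos (x + y) = 2 * sin x * sin y.
  by rewrite cosB cosD; ring.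
have p1 : 0 < 2 * sin (pi * (s' - s)) * sin (pi * (t' - t)).
  by rewrite !mulr_gt0 ?S //; lra.
have p2 : 0 < 2 * sin (pi * (t' - s)) * sin (pi * (t - s')).
  by rewrite !mulr_gt0 ?S //; lra.
move: p1 p2; rewrite -!hp.
set D := pi * (s' + t') - pi * (s + t).
have -> : pi * (s' - s) + pi * (t' - t) = D by rewrite /D; ring.
have -> : pi * (t' - s) - pi * (t - s') = D by rewrite /D; ring.
have -> : pi * (s' - s) - pi * (t' - t) = pi * (t - s) - pi * (t' - s') by ring.
have -> : pi * (t' - s) + pi * (t - s') = pi * (t - s) + pi * (t' - s') by ring.
move: (cos D) => c; rewrite -!sin2cos2 cosB cosD => p1 p2.
by have := mulr_gt0 p1 p2; lra.
Qed.

Lemma ord3P (P : 'I_3 -> Prop) : P 0 -> P 1 -> P 2 -> forall i, P i.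
Proof.
move=> P0 P1 P2 [[|[|[|//]]] lt].
- by rewrite (_ : Ordinal lt = 0) //; apply: val_inj.
- by rewrite (_ : Ordinal lt = 1) //; apply: val_inj.
- by rewrite (_ : Ordinal lt = 2) //; apply: val_inj.
Qed.

Lemma lrshift3E : (((lshift 3 (0 : 'I_3) = 0) * (lshift 3 (1 : 'I_3) = 1)
  * (lshift 3 (2 : 'I_3) = 2)) * ((rshift 3 (0 : 'I_3) = 3)
  * (rshift 3 (1 : 'I_3) = 4) * (rshift 3 (2 : 'I_3) = 5)))%type.
Proof. by do !split; apply: val_inj. Qed.

Lemma addr3E :
  (((0 + 1)%R = 1 :> 'I_3) * ((0 + 2)%R = 2 :> 'I_3) *
   ((1 + 1)%R = 2 :> 'I_3) * ((1 + 2)%R = 0 :> 'I_3) *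
   ((2 + 1)%R = 0 :> 'I_3) * ((2 + 2)%R = 1 :> 'I_3))%type.
Proof. by do !split; apply: val_inj. Qed.

Lemma cyclic_orderE (R : realType) (a : 'I_6 -> R) : cyclic_order a ->
  [/\ a 0 < a 1, a 1 < a 2, a 2 < a 3 & a 3 < a 4] /\ a 4 < a 5 /\ a 5 < a 0 + 1.
Proof.
move=> [inc last]; split; [split; exact: inc|split; first exact: inc].
by rewrite (_ : 5 = ord_max) //; apply: val_inj.
Qed.

Lemma pole_cosE (R : realType) (a : 'I_6 -> R) :
  ((pole_cos a 0 = cos (pi * (a 3 - a 0))) *
   (pole_cos a 1 = - cos (pi * (a 4 - a 1))) *
   (pole_cos a 2 = cos (pi * (a 5 - a 2))))%type.
Proof.
by rewrite /pole_cos !lrshift3E expr0 expr1 sqrrN expr1n mulN1r !mul1r.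
Qed.

Lemma pole_dirE (R : realType) (a : 'I_6 -> R) :
  ((pole_dir a 0 = unit_point (pi * (a 0 + a 3))) *
   (pole_dir a 1 = - unit_point (pi * (a 1 + a 4))) *
   (pole_dir a 2 = unit_point (pi * (a 2 + a 5))))%type.
Proof.
by rewrite /pole_dir !lrshift3E expr0 expr1 sqrrN expr1n mulN1r !mul1r.
Qed.

Lemma pole_formN (R : realType) (C : R) (u z : R[i]) :
  pole_form (- C) (- u) z = - pole_form C u z.
Proof. by case: u z => [? ?] [? ?]; rewrite /pole_form !dotE /=; lra. Qed.

Lemma sideE (R : realType) (a : 'I_6 -> R) : cyclic_order a -> forall i,
  side a i = [set z | disk z /\ pole_form (pole_cos a i) (pole_dir a i) z = 0].
Proof.
move=> /cyclic_orderE[[h0 h1 h2 h3] [h4 h5]].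
elim/ord3P;
  (rewrite /side !lrshift3E pole_cosE pole_dirE bdpt_geodesic; [|lra..]) => //.
by apply/seteqP; split=> z [dz /eqP h]; split=> //; apply/eqP;
   move: h; rewrite pole_formN oppr_eq0.
Qed.

Lemma sqnorm_pole_dir (R : realType) (a : 'I_6 -> R) i : sqnorm (pole_dir a i) = 1.
Proof.
elim/ord3P: i; rewrite pole_dirE /sqnorm /= ?sqrrN; exact: cos2Dsin2.
Qed.

Lemma dot_unit_point (R : realType) (x y : R) :
  dot (unit_point x) (unit_point y) = cos (y - x).
Proof. by rewrite dotE cosB /=; ring. Qed.

Lemma cross_unit_point (R : realType) (x y : R) :
  cross (unit_point x) (unit_point y) = sin (y - x).
Proof. by rewrite /cross sinB /=; ring. Qed.

Lemma crossC (R : realType) (u v : R[i]) : cross v u = - cross u v.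
Proof. by rewrite /cross; ring. Qed.

Lemma crossNl (R : realType) (u v : R[i]) : cross (- u) v = - cross u v.
Proof. by case: u v => [? ?] [? ?]; rewrite /cross /=; ring. Qed.

Lemma crossNr (R : realType) (u v : R[i]) : cross u (- v) = - cross u v.
Proof. by case: u v => [? ?] [? ?]; rewrite /cross /=; ring. Qed.

Lemma dotC (R : realType) (u v : R[i]) : dot u v = dot v u.
Proof. by rewrite !dotE; ring. Qed.

Lemma dotNl (R : realType) (u v : R[i]) : dot (- u) v = - dot u v.
Proof. by case: u v => [? ?] [? ?]; rewrite !dotE /=; ring. Qed.

(** The unreversed arguments increase by less than [pi] in total from pole 0 to pole 2, so only the
    product of poles 2 and 0 would be negative. Reversing pole 1 flips the other two. *)
Lemma cross_pole_dir_lt0 (R : realType) (a : 'I_6 -> R) : cyclic_order a ->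
  forall i, cross (pole_dir a (i + 1)) (pole_dir a (i + 2)) < 0.
Proof.
move=> /cyclic_orderE[[h0 h1 h2 h3] [h4 h5]].
have S (x y : R) : 0 < y - x < 1 -> 0 < sin (pi * y - pi * x).
  move=> /andP[xy0 xy1]; rewrite -mulrBr; apply: sin_gt0_pi.
  by rewrite mulr_gt0 ?pi_gt0 //= gtr_pMr ?pi_gt0.
elim/ord3P; rewrite !addr3E !pole_dirE ?crossNl ?crossNr.
- by rewrite oppr_lt0 cross_unit_point S //; lra.
- by rewrite crossC oppr_lt0 cross_unit_point S //; lra.
- by rewrite oppr_lt0 cross_unit_point S //; lra.
Qed.

Lemma pole_crossing (R : realType) (a : 'I_6 -> R) : cyclic_order a ->
  forall i, (dot (pole_dir a (i + 1)) (pole_dir a (i + 2)) -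
             pole_cos a (i + 1) * pole_cos a (i + 2)) ^+ 2 <
            (1 - pole_cos a (i + 1) ^+ 2) * (1 - pole_cos a (i + 2) ^+ 2).
Proof.
move=> /cyclic_orderE[[h0 h1 h2 h3] [h4 h5]].
elim/ord3P; rewrite !addr3E !pole_dirE !pole_cosE ?sqrrN.
- rewrite dotNl dot_unit_point mulNr -opprD sqrrN; apply: crossing => //; lra.
- rewrite dotC dot_unit_point [X in _ - X]mulrC [ltRHS]mulrC; apply: crossing => //; lra.
- rewrite dotC dotNl dotC dot_unit_point mulrN -opprD sqrrN; apply: crossing => //; lra.
Qed.

(** The determinant with rows [(u_i, C_i)], expanded along the last column. It vanishes when the
    geodesics are concurrent. *)
Definition pole_det (R : realType) (a : 'I_6 -> R) : R :=
  \sum_i pole_cos a i * cross (pole_dir a (i + 1)) (pole_dir a (i + 2)).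

(** For a unit vector [u], the Lorentz square of [(u, C)] is [1 - C ^+ 2]. *)
Definition inner_cos (R : realType) (a : 'I_6 -> R) (i : 'I_3) : R :=
  - (dot (pole_dir a (i + 1)) (pole_dir a (i + 2)) -
     pole_cos a (i + 1) * pole_cos a (i + 2)) /
  (Num.sqrt (1 - pole_cos a (i + 1) ^+ 2) *
   Num.sqrt (1 - pole_cos a (i + 2) ^+ 2)).

Lemma sum3E (R : realType) (F : 'I_3 -> R) (i : 'I_3) :
  \sum_j F j = F i + F (i + 1) + F (i + 2).
Proof.
rewrite !big_ord_recl big_ord0 addr0.
have -> : lift ord0 (ord0 : 'I_2) = 1 :> 'I_3 by apply: val_inj.
have -> : lift ord0 (lift ord0 (ord0 : 'I_1)) = 2 :> 'I_3 by apply: val_inj.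
rewrite (_ : ord0 = 0) //; elim/ord3P: i; rewrite !addr3E; ring.
Qed.

(** Any two sides cross inside the disk, so [xget] never falls back on its default. *)
Lemma triangle_sides (R : realType) (a : 'I_6 -> R) : cyclic_order a ->
  forall i, side a (i + 1) (triangle a i) /\ side a (i + 2) (triangle a i).
Proof.
move=> co i; rewrite /triangle; case: xgetP => [z -> [] // |none].
have c := cross_pole_dir_lt0 co i.
have [|z [dz z1 z2]] := pole_form_inter (sqnorm_pole_dir a (i + 1))
  (sqnorm_pole_dir a (i + 2)) _ (pole_crossing co i).
  by rewrite lt_eqF.
by case: (none z); split; rewrite sideE.
Qed.

Lemma angle_triangle (R : realType) (a : 'I_6 -> R) : cyclic_order a ->
  pole_det a != 0 -> angles (triangle a) = \row_i acos (inner_cos a i).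
Proof.
move=> co D0; apply/rowP => i; rewrite !mxE.
have ii : (((i + 1 + 1)%R = (i + 2)%R) * ((i + 1 + 2)%R = i) *
    ((i + 2 + 1)%R = i) * ((i + 2 + 2)%R = (i + 1)%R))%type.
  by elim/ord3P: i; rewrite !addr3E.
have := triangle_sides co i; have := triangle_sides co (i + 1).
have := triangle_sides co (i + 2); rewrite !ii !sideE //=.
move=> [[d2 z02] [_ z12]] [[d1 z21] [_ z01]] [[d0 z10] [_ z20]].
rewrite (angle_vertex d0 d1 d2 z10 z20 z21 z01 z02 z12).
- by rewrite !sqnorm_pole_dir.
- have := cross_pole_dir_lt0 co (i + 1); have := cross_pole_dir_lt0 co (i + 2).
  by rewrite !ii => h1 h2; rewrite nmulr_rgt0.
by move: D0; rewrite /pole_det (sum3E _ i) !ii.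
Qed.

(** If the determinant vanishes, Cramer's rule puts vertex 0 on side 0 as well. Vertices 0 and 1
    then both lie on sides 2 and 0, hence coincide. *)
Lemma nondegenerate_pole_det (R : realType) (a : 'I_6 -> R) : cyclic_order a ->
  nondegenerate (triangle a) -> pole_det a != 0.
Proof.
move=> co inj; apply/eqP => D0.
have := triangle_sides co 0; have := triangle_sides co 1; rewrite !addr3E !sideE //=.
move=> [[d1 z21] [_ z01]] [[d0 z10] [_ z20]].
have c0 := cross_pole_dir_lt0 co 0; have c1 := cross_pole_dir_lt0 co 1.
rewrite !addr3E in c0 c1.
have z00 : pole_form (pole_cos a 0) (pole_dir a 0) (triangle a 0) = 0.
  apply/eqP; have /eqP := pole_form_vertex (pole_cos a 0) (pole_dir a 0) z10 z20.
  rewrite (_ : _ + _ + _ = pole_det a); last first.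
    by rewrite /pole_det (sum3E _ 0) !addr3E.
  by rewrite D0 mulr0 mulf_eq0 [X in _ || X]lt_eqF // orbF.
suff /inj : triangle a 0 = triangle a 1 by [].
by apply: (pole_form_inter_eq _ d0 d1 z20 z00 z21 z01); rewrite lt_eqF.
Qed.

(** * Iteration of [A] on arc vectors *)

Lemma sum6E (R : realType) (F : 'I_6 -> R) :
  \sum_i F i = F 0 + F 1 + F 2 + F 3 + F 4 + F 5.
Proof.
rewrite !big_ord_recl big_ord0 addr0 !addrA.
by do !congr (_ + _); congr F; apply: val_inj.
Qed.

Lemma ord6P (P : 'I_6 -> Prop) :
  P 0 -> P 1 -> P 2 -> P 3 -> P 4 -> P 5 -> forall i, P i.
Proof.
move=> P0 P1 P2 P3 P4 P5 [[|[|[|[|[|[|//]]]]]] lt].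
- by rewrite (_ : Ordinal lt = 0) //; apply: val_inj.
- by rewrite (_ : Ordinal lt = 1) //; apply: val_inj.
- by rewrite (_ : Ordinal lt = 2) //; apply: val_inj.
- by rewrite (_ : Ordinal lt = 3) //; apply: val_inj.
- by rewrite (_ : Ordinal lt = 4) //; apply: val_inj.
- by rewrite (_ : Ordinal lt = 5) //; apply: val_inj.
Qed.

Lemma endpointsE (R : realType) (b : 'cV[R]_6) :
  ((endpoints b 0 = 0) * (endpoints b 1 = (b 0 ord0)%R) *
   (endpoints b 2 = (b 0 ord0 + b 1 ord0)%R) *
   (endpoints b 3 = (b 0 ord0 + b 1 ord0 + b 2 ord0)%R) *
   (endpoints b 4 = (b 0 ord0 + b 1 ord0 + b 2 ord0 + b 3 ord0)%R) *
   (endpoints b 5 = (b 0 ord0 + b 1 ord0 + b 2 ord0 + b 3 ord0 + b 4 ord0)%R))%type.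
Proof.
by rewrite /endpoints !(big_mkcond (fun k : 'I_6 => (k < _)%N)) !sum6E /= !addr0.
Qed.

Lemma balancedE (R : realType) (b : 'cV[R]_6) :
  balanced b <->
  b 0 ord0 + b 2 ord0 + b 4 ord0 = b 1 ord0 + b 3 ord0 + b 5 ord0.
Proof.
by rewrite /balanced (big_mkcond (fun j : 'I_6 => ~~ odd j))
  (big_mkcond (fun j : 'I_6 => odd j)) !sum6E /= !(addr0, add0r).
Qed.

Definition arc_vector (R : realType) (b : 'cV[R]_6) : Prop :=
  (forall j, 0 < b j ord0) /\ \sum_j b j ord0 = 1.

Lemma arcs_arc_vector (R : realType) (a : 'I_6 -> R) :
  cyclic_order a -> arc_vector (arcs a).
Proof.
move=> /cyclic_orderE[[h0 h1 h2 h3] [h4 h5]].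
have e1 : (((0 + 1)%R = 1 :> 'I_6) * ((1 + 1)%R = 2 :> 'I_6) *
    ((2 + 1)%R = 3 :> 'I_6) * ((3 + 1)%R = 4 :> 'I_6) *
    ((4 + 1)%R = 5 :> 'I_6) * ((5 + 1)%R = 0 :> 'I_6))%type.
  by do !split; apply: val_inj.
split; first by elim/ord6P; rewrite mxE e1 /= ?addr0; lra.
by rewrite sum6E !mxE !e1 /=; lra.
Qed.

Lemma endpoints_cyclic (R : realType) (b : 'cV[R]_6) :
  arc_vector b -> cyclic_order (endpoints b).
Proof.
move=> [b_gt0 b1]; split=> [i j ij|].
  rewrite /endpoints [ltRHS](bigID (fun k : 'I_6 => (k < i)%N)) /=.
  rewrite [X in _ < X + _](eq_bigl (fun k : 'I_6 => (k < i)%N)); last first.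
    by move=> k /=; case: (ltnP k i) => ki; rewrite ?andbF // (ltn_trans ki).
  rewrite ltrDl (bigD1 i) /= ?ltnn ?ij //.
  by rewrite ltr_pwDl // sumr_ge0 // => k _; exact: ltW.
rewrite (_ : ord_max = 5); last exact: val_inj.
rewrite (_ : ord0 = 0) // !endpointsE add0r -b1 sum6E ltrDl; exact: b_gt0.
Qed.

Lemma mulA_E (R : realType) (b : 'cV[R]_6) j :
  (A *m b) j ord0 = (b j ord0 + b (j + 2) ord0) / 2.
Proof.
have delta (i : 'I_6) : \sum_k (k == i)%:R * b k ord0 = b i ord0.
  rewrite (bigD1 i) //= eqxx mul1r big1 ?addr0 // => k /negPf->; exact: mul0r.
rewrite mxE -(delta j) -(delta (j + 2)) -big_split big_distrl /=.
by apply: eq_bigr => k _; rewrite mxE; ring.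
Qed.

Lemma arc_vector_mulA (R : realType) (b : 'cV[R]_6) :
  arc_vector b -> arc_vector (A *m b).
Proof.
move=> [b_gt0 b1]; split=> [j|].
  by rewrite mulA_E divr_gt0 // addr_gt0.
under eq_bigr do rewrite mulA_E.
rewrite -big_distrl /= big_split /= [X in _ + X](_ : _ = 1); last first.
  by rewrite -b1 [in RHS](reindex_inj (addIr 2)).
by rewrite b1; lra.
Qed.

Lemma arc_vector_powA (R : realType) (b : 'cV[R]_6) n :
  arc_vector b -> arc_vector (A ^+ n *m b).
Proof.
move=> hb; elim: n => [|n IHn]; first by rewrite expr0 mul1mx.
by rewrite exprS -mulmxE -mulmxA; exact: arc_vector_mulA.
Qed.

Definition class_mean (R : realType) (b : 'cV[R]_6) (j : 'I_6) : R :=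
  (b j ord0 + b (j + 2) ord0 + b (j + 4) ord0) / 3.

Lemma add6E (j : 'I_6) :
  (((j + 2 + 2)%R = (j + 4)%R) * ((j + 4 + 2)%R = j) * ((j + 2 + 4)%R = j))%type.
Proof. by elim/ord6P: j; do !split; apply: val_inj. Qed.

Lemma class_mean_mulA (R : realType) (b : 'cV[R]_6) j :
  class_mean (A *m b) j = class_mean b j.
Proof. by rewrite /class_mean !mulA_E !add6E; field. Qed.

Lemma class_mean_powA (R : realType) (b : 'cV[R]_6) n j :
  class_mean (A ^+ n *m b) j = class_mean b j.
Proof.
elim: n => [|n IHn]; first by rewrite expr0 mul1mx.
by rewrite exprS -mulmxE -mulmxA class_mean_mulA.
Qed.

Lemma class_mean2 (R : realType) (b : 'cV[R]_6) j :
  class_mean b (j + 2) = class_mean b j.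
Proof. by rewrite /class_mean !add6E; ring. Qed.

(** The constant sums over all indices because the induction step passes from [j] to [j + 4]. *)
Lemma powA_dist (R : realType) (b : 'cV[R]_6) n j :
  `|(A ^+ n *m b) j ord0 - class_mean b j| <=
  (\sum_k `|b k ord0 - class_mean b k|) * 2^-1 ^+ n.
Proof.
elim: n j => [|n IHn] j.
  rewrite expr0 mul1mx expr0 mulr1 (bigD1 j) //= lerDl.
  by apply: sumr_ge0 => k _.
rewrite exprS -mulmxE -mulmxA mulA_E.
(* The three entries of a parity class always sum to three times the initial mean, so two of them
   are controlled by the third. *)
have -> : ((A ^+ n *m b) j ord0 + (A ^+ n *m b) (j + 2) ord0) / 2 - class_mean b j =
          - ((A ^+ n *m b) (j + 4) ord0 - class_mean b (j + 4)) / 2.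
  have <- : class_mean b j = class_mean b (j + 4).
    by rewrite -(add6E j).1.1 !class_mean2.
  by rewrite -(class_mean_powA b n j) /class_mean; field.
rewrite normrM normrN (ger0_norm (_ : 0 <= 2^-1)) // exprSr mulrA.
by rewrite ler_wpM2r.
Qed.

Lemma powA_cvg (R : realType) (b : 'cV[R]_6) j :
  (A ^+ n *m b) j ord0 @[n --> \oo] --> class_mean b j.
Proof.
apply/subr_cvg0/norm_cvg0P.
apply: (squeeze_cvgr (f := fun=> 0)
  (h := fun n => (\sum_k `|b k ord0 - class_mean b k|) * 2^-1 ^+ n)).
- by apply: nearW => n; rewrite normr_ge0 powA_dist.
- exact: cvg_cst.
rewrite -[X in _ --> X](mulr0 (\sum_k `|b k ord0 - class_mean b k|)).
apply: cvgMl_tmp; apply: cvg_expr; rewrite ger0_norm //; lra.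
Qed.

(** * Trigonometry at [pi / 3] and continuity of the angles *)

Lemma cos_pi3 (R : realType) : cos (pi / 3 : R) = 2^-1.
Proof.
have p0 := pi_gt0 R; set x := pi / 3.
have c0 : 0 < cos x by apply: cos_gt0_pihalf; rewrite /x; apply/andP; split; lra.
have : cos (x + x + x) = -1 by rewrite -cospi; congr cos; rewrite /x; lra.
rewrite !cosD !sinD; have := sin2cos2 x.
move: (cos x) (sin x) c0 => c s c0 s2 e.
(* The triple angle formula turns [e] into [4 c^3 - 3 c + 1 = 0], which factors this way. *)
have : (c + 1) * (2 * c - 1) ^+ 2 = 0.
  by move: (congr1 ( *%R (3 * c)) s2) e; lra.
move/eqP; rewrite mulf_eq0 gt_eqF ?addr_gt0 //= expf_eq0 /= => /eqP; lra.
Qed.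

Lemma sin_pi3_gt0 (R : realType) : 0 < sin (pi / 3 : R).
Proof. by apply: sin_gt0_pi; have := pi_gt0 R => ?; apply/andP; split; lra. Qed.

Lemma comp_cvg (R : realType) (T : Type) (F : set_system T) (FF : Filter F)
    (h : R -> R) (f : T -> R) (x : R) :
  {for x, continuous h} -> f @ F --> x -> h (f n) @[n --> F] --> h x.
Proof. exact: continuous_cvg. Qed.

Definition ends_cvg (R : realType) (T : Type) (F : set_system T)
  (a : T -> 'I_6 -> R) (l : 'I_6 -> R) := forall k, a n k @[n --> F] --> l k.

Lemma pole_cos_cvg (R : realType) (T : Type) (F : set_system T) (FF : Filter F)
    (a : T -> 'I_6 -> R) (l : 'I_6 -> R) : ends_cvg F a l ->
  forall i, pole_cos (a n) i @[n --> F] --> pole_cos l i.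
Proof.
move=> al i; apply: cvgMl_tmp; apply: comp_cvg; first exact: continuous_cos.
by apply: cvgMl_tmp; apply: cvgB; exact: al.
Qed.

Lemma unit_point_signE (R : realType) (x : R) (i : 'I_3) :
  (-1) ^+ i * unit_point x = ((-1) ^+ i * cos x) +i* ((-1) ^+ i * sin x).
Proof.
by elim/ord3P: i; rewrite ?expr0 ?expr1 ?sqrrN ?expr1n ?mulN1r ?mul1r.
Qed.

Lemma pole_dir_cvg (R : realType) (T : Type) (F : set_system T) (FF : Filter F)
    (a : T -> 'I_6 -> R) (l : 'I_6 -> R) : ends_cvg F a l -> forall i,
  complex.Re (pole_dir (a n) i) @[n --> F] --> complex.Re (pole_dir l i) /\
  complex.Im (pole_dir (a n) i) @[n --> F] --> complex.Im (pole_dir l i).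
Proof.
move=> al i; rewrite /pole_dir unit_point_signE /=.
split; under eq_cvg do rewrite unit_point_signE /=; apply: cvgMl_tmp;
  (apply: comp_cvg; first by (exact: continuous_cos || exact: continuous_sin));
  by apply: cvgMl_tmp; apply: cvgD; exact: al.
Qed.

Lemma pole_det_cvg (R : realType) (T : Type) (F : set_system T) (FF : Filter F)
    (a : T -> 'I_6 -> R) (l : 'I_6 -> R) : ends_cvg F a l ->
  pole_det (a n) @[n --> F] --> pole_det l.
Proof.
move=> al; rewrite /pole_det (sum3E _ 0); under eq_cvg do rewrite (sum3E _ 0).
have C := pole_cos_cvg FF al; have u i := (pole_dir_cvg FF al i).1.
have v i := (pole_dir_cvg FF al i).2.
have term i j k : pole_cos (a n) i * cross (pole_dir (a n) j) (pole_dir (a n) k)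
     @[n --> F] --> pole_cos l i * cross (pole_dir l j) (pole_dir l k).
  apply: cvgM; first exact: C.
  by apply: cvgB; apply: cvgM; [exact: u|exact: v|exact: v|exact: u].
by apply: cvgD; [apply: cvgD|]; exact: term.
Qed.

Lemma inner_cos_cvg (R : realType) (T : Type) (F : set_system T) (FF : Filter F)
    (a : T -> 'I_6 -> R) (l : 'I_6 -> R) (i : 'I_3) : ends_cvg F a l ->
  pole_cos l (i + 1) ^+ 2 < 1 -> pole_cos l (i + 2) ^+ 2 < 1 ->
  inner_cos (a n) i @[n --> F] --> inner_cos l i.
Proof.
move=> al C1 C2; rewrite /inner_cos.
have C := pole_cos_cvg FF al; have u j := (pole_dir_cvg FF al j).1.
have v j := (pole_dir_cvg FF al j).2.
apply: cvgM.
  apply: cvgN; apply: cvgB; last by apply: cvgM; exact: C.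
  rewrite dotE; under eq_cvg do rewrite dotE.
  by apply: cvgD; apply: cvgM; [exact: u|exact: u|exact: v|exact: v].
have sq j : Num.sqrt (1 - pole_cos (a n) j ^+ 2) @[n --> F] -->
            Num.sqrt (1 - pole_cos l j ^+ 2).
  apply: comp_cvg; first exact: sqrt_continuous.
  apply: cvgB; first exact: cvg_cst.
  by under eq_cvg do rewrite expr2; rewrite expr2; apply: cvgM; exact: C.
apply: cvgV; last by apply: cvgM; exact: sq.
by rewrite mulf_neq0 // gt_eqF // sqrtr_gt0 subr_gt0.
Qed.

(** The filter is arbitrary so as to cover both [\oo] and its restriction to nondegenerate indices.
    The bounds on [t] keep [cos t] in the open interval where [acos] is continuous. *)
Lemma angles_cvg (R : realType) (T : Type) (F : set_system T) (FF : Filter F)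
    (a : T -> 'I_6 -> R) (l : 'I_6 -> R) (t : R) : ends_cvg F a l ->
  (forall n, cyclic_order (a n)) -> (\forall n \near F, pole_det (a n) != 0) ->
  (forall i, pole_cos l i ^+ 2 < 1) -> (forall i, inner_cos l i = cos t) ->
  0 < t < pi ->
  euclidean_norm (angles (triangle (a n)) - const_mx t) @[n --> F] --> (0 : R).
Proof.
move=> al co D0 C2 inner /andP[t0 tpi].
have tI : t \in `[0, pi] by rewrite in_itv /= !ltW.
have ac i : acos (inner_cos (a n) i) @[n --> F] --> t.
  rewrite -(cosK tI) -(inner i); apply: comp_cvg; last exact: inner_cos_cvg.
  apply: continuous_acos; rewrite inner -{1}cospi -cos0.
  by rewrite !ltr_cos ?t0 ?tpi // in_itv /= ?lexx ?pi_ge0.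
have : Num.sqrt (\sum_(i < 3) (acos (inner_cos (a n) i) - t) ^+ 2) @[n --> F]
    --> (0 : R).
  suff : Num.sqrt (\sum_(i < 3) (acos (inner_cos (a n) i) - t) ^+ 2) @[n --> F]
      --> Num.sqrt (0 : R) by rewrite sqrtr0.
  apply: (@comp_cvg _ _ _ FF (@Num.sqrt R) _ 0); first exact: sqrt_continuous.
  have s i : (acos (inner_cos (a n) i) - t) ^+ 2 @[n --> F] --> (0 : R).
    have d : acos (inner_cos (a n) i) - t @[n --> F] --> (0 : R).
      by apply/subr_cvg0; exact: ac.
    suff : (acos (inner_cos (a n) i) - t) ^+ 2 @[n --> F] --> (0 * 0 : R).
      by rewrite mulr0.
    by under eq_cvg do rewrite expr2; apply: cvgM.
  suff : \sum_(i < 3) (acos (inner_cos (a n) i) - t) ^+ 2 @[n --> F]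
      --> (0 + 0 + 0 : R) by rewrite !addr0.
  under eq_cvg do rewrite (sum3E _ 0).
  by apply: cvgD; [apply: cvgD|]; exact: s.
(* The formula for the angles is available only where the determinant is nonzero, which holds
   eventually along [F]. *)
apply: cvg_trans; apply: near_eq_cvg; near=> n.
rewrite angle_triangle //; last by near: n.
by rewrite /euclidean_norm; congr Num.sqrt; apply: eq_bigr => i _; rewrite !mxE.
Unshelve. all: end_near.
Qed.

(** * The limiting configuration *)

Lemma cos_piM1B (R : realType) (x : R) : cos (pi * (1 - x)) = - cos (pi * x).
Proof. by rewrite mulrBr mulr1 addrC cosDpi cosN. Qed.

Lemma sin_piM1B (R : realType) (x : R) : sin (pi * (1 - x)) = sin (pi * x).
Proof. by rewrite mulrBr mulr1 addrC sinDpi sinN opprK. Qed.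

(** Sides 0 and 2 cut off arcs of length [1/3 + e] and side 1 the complementary length, which its
    reversal compensates. The arguments of the poles advance by [pi / 3], so after the reversal the
    three poles are a third of a turn apart. *)
Lemma regular_poles (R : realType) (a : 'I_6 -> R) (e : R) :
  a 1 - a 0 = e -> a 2 - a 1 = 3^-1 - e -> a 3 - a 2 = e ->
  a 4 - a 3 = 3^-1 - e -> a 5 - a 4 = e ->
  [/\ forall i, pole_cos a i = cos (pi * (3^-1 + e)),
      forall i, dot (pole_dir a (i + 1)) (pole_dir a (i + 2)) = - 2^-1 &
      forall i, cross (pole_dir a (i + 1)) (pole_dir a (i + 2)) =
                - sin (pi / 3)].
Proof.
move=> h0 h1 h2 h3 h4.
have c23 := cos_piM1B (3^-1 : R); have s23 := sin_piM1B (3^-1 : R).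
rewrite cos_pi3 in c23.
split; elim/ord3P; rewrite ?addr3E ?pole_cosE ?pole_dirE.
- by congr cos; congr (_ * _); lra.
- have -> : a 4 - a 1 = 1 - (3^-1 + e) by lra.
  by rewrite cos_piM1B opprK.
- by congr cos; congr (_ * _); lra.
- rewrite dotNl dot_unit_point -cos_pi3; congr (- cos _).
  rewrite -mulrBr; congr (_ * _); lra.
- rewrite dotC dot_unit_point -c23 -mulrBr; congr (cos (_ * _)); lra.
- rewrite dotC dotNl dotC dot_unit_point -cos_pi3; congr (- cos _).
  rewrite -mulrBr; congr (_ * _); lra.
- rewrite crossNl cross_unit_point; congr (- sin _).
  rewrite -mulrBr; congr (_ * _); lra.
- rewrite crossC cross_unit_point -s23; congr (- sin _).
  rewrite -mulrBr; congr (_ * _); lra.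
- rewrite crossNr cross_unit_point; congr (- sin _).
  rewrite -mulrBr; congr (_ * _); lra.
Qed.

Lemma regular_inner_cos (R : realType) (a : 'I_6 -> R) (C : R) :
  C ^+ 2 < 1 ->
  (forall i, pole_cos a i = C) ->
  (forall i, dot (pole_dir a (i + 1)) (pole_dir a (i + 2)) = - 2^-1) ->
  forall i, inner_cos a i = (2^-1 + C ^+ 2) / (1 - C ^+ 2).
Proof.
move=> C1 hC hd i; rewrite /inner_cos hd !hC -!expr2 sqr_sqrtr ?subr_ge0 ?ltW //.
by congr (_ / _); ring.
Qed.

Lemma endpoints_powA_cvg (R : realType) (b : 'cV[R]_6) :
  ends_cvg \oo (fun n => endpoints (A ^+ n *m b))
    (endpoints (\col_j class_mean b j)).
Proof.
have c j : (A ^+ n *m b) j ord0 @[n --> \oo] --> (\col_j class_mean b j) j ord0.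
  by rewrite mxE; exact: powA_cvg.
elim/ord6P; under eq_cvg do rewrite endpointsE; rewrite endpointsE.
- exact: cvg_cst.
- exact: c.
- by apply: cvgD; exact: c.
- by apply: cvgD; [apply: cvgD|]; exact: c.
- by apply: cvgD; [apply: cvgD; [apply: cvgD|]|]; exact: c.
- by apply: cvgD; [apply: cvgD; [apply: cvgD; [apply: cvgD|]|]|]; exact: c.
Qed.

Lemma class_mean_regular (R : realType) (b : 'cV[R]_6) : arc_vector b ->
  [/\ class_mean b 2 = class_mean b 0, class_mean b 4 = class_mean b 0,
      class_mean b 1 = 3^-1 - class_mean b 0 &
      class_mean b 3 = 3^-1 - class_mean b 0].
Proof.
move=> [_]; rewrite sum6E => b1.
have m2 : class_mean b 2 = class_mean b 0 by rewrite -[2]add0r class_mean2.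
have m4 : class_mean b 4 = class_mean b 0.
  by rewrite -class_mean2 (_ : 4 + 2 = 0) //; apply: val_inj.
have m3 : class_mean b 3 = class_mean b 1.
  by rewrite -class_mean2 -class_mean2 (_ : 3 + 2 + 2 = 1) //; apply: val_inj.
have m1 : class_mean b 1 = 3^-1 - class_mean b 0.
  rewrite /class_mean !add0r (_ : 1 + 2 = 3); last exact: val_inj.
  by rewrite (_ : 1 + 4 = 5); [lra|exact: val_inj].
by split; rewrite ?m3.
Qed.

Lemma class_mean0_bounds (R : realType) (b : 'cV[R]_6) : arc_vector b ->
  0 < class_mean b 0 < 3^-1 /\ (class_mean b 0 = 6^-1 <-> balanced b).
Proof.
move=> [b_gt0]; rewrite sum6E balancedE /class_mean !add0r.
move: (b_gt0 0) (b_gt0 1) (b_gt0 2) (b_gt0 3) (b_gt0 4) (b_gt0 5) => {b_gt0}.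
move: (b 0 ord0) (b 1 ord0) (b 2 ord0) (b 3 ord0) (b 4 ord0) (b 5 ord0).
move=> b0 b1 b2 b3 b4 b5 h0 h1 h2 h3 h4 h5 b_sum.
by split; [apply/andP; split|split=> ?]; lra.
Qed.

(** The argument lies strictly between [pi / 3] and [2 pi / 3], and cosine is strictly decreasing on
    [[0, pi]]. *)
Lemma cos_near_pihalf (R : realType) (e : R) : 0 < e < 3^-1 ->
  cos (pi * (3^-1 + e)) ^+ 2 < 4^-1 /\
  (cos (pi * (3^-1 + e)) = 0 <-> e = 6^-1).
Proof.
move=> /andP[e_gt0 e_lt]; have p0 := pi_gt0 R.
have piI (x : R) : 0 <= x -> x <= 1 -> pi * x \in `[0, pi].
  by move=> x0 x1; rewrite in_itv /= mulr_ge0 ?(ltW p0) //= ger_pMr.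
have ltc (x y : R) : 0 <= x -> x < y -> y <= 1 -> cos (pi * y) < cos (pi * x).
  move=> x0 xy y1; rewrite ltr_cos ?ltr_pM2l ?piI //; lra.
split; last first.
  split=> [|->]; rewrite -cos_pihalf; last by congr (cos (_ * _)); lra.
  have xI : pi * (3^-1 + e) \in `[0, pi] by apply: piI; lra.
  have hI : (pi / 2 : R) \in `[0, pi] by apply: piI; lra.
  by move=> /(cos_inj xI hI) /(mulfI (lt0r_neq0 p0)); lra.
have C_lt : cos (pi * (3^-1 + e)) < 2^-1 by rewrite -cos_pi3 ltc //; lra.
have C_gt : - 2^-1 < cos (pi * (3^-1 + e)).
  by rewrite -cos_pi3 -cos_piM1B ltc //; lra.
by move: (cos _) C_lt C_gt => C *; nra.
Qed.

(** These bounds place the limiting angle above 0 and, for nonzero [C], below [pi / 3]. *)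
Lemma regular_cos_bounds (R : realType) (C : R) : C ^+ 2 < 4^-1 ->
  (2^-1 + C ^+ 2) / (1 - C ^+ 2) < 1 /\
  (C != 0 -> 2^-1 < (2^-1 + C ^+ 2) / (1 - C ^+ 2)).
Proof.
move=> C2; have C21 : 0 < 1 - C ^+ 2 by lra.
split=> [|C0]; first by rewrite ltr_pdivrMr // mul1r; lra.
have : 0 < C ^+ 2 by rewrite exprn_even_gt0.
by rewrite ltr_pdivlMr //; lra.
Qed.

Theorem theorem6 (R : realType) (a : 'I_6 -> R)
    (a_cyclic : cyclic_order a)
    (a_triangle : nondegenerate (triangle a)) :
  (~ balanced (arcs a) -> converges_to_regular (triangles (arcs a))) /\
  (balanced (arcs a) ->
    euclidean_norm (angles (triangles (arcs a) n) - const_mx (pi / 3))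
      @[n --> within [set n | nondegenerate (triangles (arcs a) n)] \oo]
      --> (0 : R)).
Proof.
move: (arcs_arc_vector a_cyclic); move: (arcs a) => b {a a_cyclic a_triangle} hb.
have cob n := endpoints_cyclic (arc_vector_powA n hb).
have [m2 m4 m1 m3] := class_mean_regular hb.
have [eI e_bal] := class_mean0_bounds hb.
have [|||||lC ld lc] :=
  @regular_poles _ (endpoints (\col_j class_mean b j)) (class_mean b 0).
- by rewrite !endpointsE !mxE subr0.
- by rewrite !endpointsE !mxE m1 addrAC subrr add0r.
- by rewrite !endpointsE !mxE m2 addrAC subrr add0r.
- by rewrite !endpointsE !mxE m3 addrAC subrr add0r.
- by rewrite !endpointsE !mxE m4 addrAC subrr add0r.
have [] := cos_near_pihalf eI; move: (cos _) lC => C lC C2; rewrite {}e_bal => C0.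
have [K1 K2] := regular_cos_bounds C2.
have C21 : C ^+ 2 < 1 by rewrite (lt_trans C2) // invf_lt1 ?ltr1n.
have := regular_inner_cos C21 lC ld; move=> {hb eI m1 m2 m3 m4 ld}.
have lim := @endpoints_powA_cvg _ b; have p0 := pi_gt0 R.
move: (endpoints _) lC lc lim => l lC lc lim inner.
split=> [unbal|/C0 {}C0].
  have {}C0 : C != 0 by apply/eqP => /C0.
  (* [K] is the common limiting cosine, now known to satisfy [1/2 < K < 1]. *)
  move: K1 (K2 C0) inner; move: (_ / _) => K K1 {}K2 inner.
  have KI : -1 < K < 1 by rewrite K1 andbT (lt_trans _ K2) //; lra.
  have KI' : -1 <= K <= 1 by case/andP: KI => *; rewrite !ltW.
  have acI : acos K \in `[0, pi] by rewrite in_itv /= acos_ge0 ?acos_lepi.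
  have p3I : (pi / 3 : R) \in `[0, pi].
    by move: p0; rewrite in_itv /=; clear; lra.
  exists (acos K); split; first exact: acos_ge0.
    by rewrite -(ltr_cos acI p3I) acosK // cos_pi3.
  apply: (@angles_cvg _ _ _ _ _ l) => //.
  (* The determinant tends to [- 3 C sin (pi / 3)], which is nonzero, so it is eventually
     nonzero. *)
  - apply: (cvgr_neq0 _ (pole_det_cvg _ lim)).
    rewrite /pole_det (sum3E _ 0) !lC !lc -!mulrDr mulf_neq0 // -!opprD oppr_eq0.
    by rewrite gt_eqF // !addr_gt0 // sin_pi3_gt0.
  - by move=> i; rewrite lC.
  - by move=> i; rewrite inner acosK.
  - case/andP: KI => KN1 _.
    by rewrite acos_gt0 ?acos_ltpi ?K1 ?KN1 ?(ltW K1) ?(ltW KN1).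
(* Here [C = 0] and the limiting determinant vanishes. That the determinants along the sequence are
   nonzero comes instead from nondegeneracy, on the restricted filter. *)
apply: (@angles_cvg _ _ _ _ _ l) => //.
- move=> k; apply: cvg_trans (lim k); apply: cvg_app; exact: cvg_within.
- rewrite near_withinE; apply: nearW => n; exact: nondegenerate_pole_det.
- by move=> i; rewrite lC.
- by move=> i; rewrite inner cos_pi3 C0 expr0n /= addr0 subr0 divr1.
- by move: p0; clear; lra.
Qed.
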